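(* The curve $$\mathcal{C}_{\pi/3,\pi/2}:\quad X^4 - X^3 + 2X^2 - X + 1 = Y^2$$ has infinitely many rational points $(X,Y)\in\mathbb{Q}^2$.
   Context: This curve arises from the pair of equations $x^2-xy+y^2=z_1^2$ and $x^2+y^2=z_2^2$ (law of cosines for triangles with two sides $x,y$ enclosing angles $\pi/3$ and $\pi/2$) by multiplying them and setting $X=x/y$, $Y=z_1z_2/y^2$. *)

(* Defs.v *)
From mathcomp Require Import all_boot all_order all_algebra.
From mathcomp Require Import classical_sets cardinality.

Set Implicit Arguments.
Unset Strict Implicit.
Unset Printing Implicit Defensive.

Import GRing.Theory.
Local Open Scope classical_set_scope.
Local Open Scope ring_scope.

(* The quartic is (X^2 - X + 1) * (X^2 + 1): the product of the two cosine laws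
   x^2 - x y + y^2 = z1^2 and x^2 + y^2 = z2^2, with X = x / y, Y = z1 z2 / y^2. *)
Definition curve_pi3_pi2 : set (rat * rat) :=
  [set P : rat * rat |
    P.1 ^+ 4 - P.1 ^+ 3 + 2 * P.1 ^+ 2 - P.1 + 1 = P.2 ^+ 2].

(* Main.v *)
Require Import Defs.
From mathcomp Require Import all_boot all_order all_algebra.
From mathcomp Require Import classical_sets cardinality.
From mathcomp Require Import ring zify.

(** The curve is birational to the elliptic curve [w^2 = u (u^2 - 4 u + 1)], with
[(X, Y) = (0, 1)] sent to the origin.  The right triangle (8, 15, 17), for which
[8^2 - 8 * 15 + 15^2 = 13^2], gives the rational point [X = 8 / 15], whose image has
[u = (15 / 4)^2].  Points with [u = (p / 2m)^2] are described by the integer triples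
[(p, m, r)] with [r^2 = p^4 - 16 p^2 m^2 + 16 m^4], and doubling preserves this
shape.  When [p] and [r] are odd, doubling increases the 2-adic valuation of [m],
hence that of [X], by exactly one; so the iterated doubles of the initial point are
pairwise distinct. *)

Set Implicit Arguments.
Unset Strict Implicit.
Unset Printing Implicit Defensive.

Import GRing.Theory.
Local Open Scope ring_scope.

Definition on_model (K : pzRingType) (p m r : K) : Prop :=
  r ^+ 2 = p ^+ 4 - 16 * p ^+ 2 * m ^+ 2 + 16 * m ^+ 4.

(** With [curveY], inverts the birational map with first coordinate
    [u = (2 Y + 2 X^2 - X + 2) / X^2], at [u = (p / 2m)^2], [w = p r / 8m^3]. *)
Definition curveX (p m r : rat) : rat :=
  4 * m * (p ^+ 2 - m ^+ 2) / (p * (r + p * m)).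

Definition curveY (p m r : rat) : rat :=
  2 * ((p ^+ 2 - m ^+ 2) / (r + p * m)) ^+ 2
  - curveX p m r ^+ 2 + curveX p m r / 2 - 1.

Lemma curve_of_model (p m r : rat) :
    on_model p m r -> p != 0 -> r + p * m != 0 ->
  curve_pi3_pi2 (curveX p m r, curveY p m r).
Proof.
rewrite /on_model /curve_pi3_pi2 /= /curveY /curveX => Hr p0 d0.
by field: Hr; rewrite d0.
Qed.

(** Duplication [u(2P) = ((u^2 - 1) / 2w)^2]: its square root is the new [p / 2m]. *)
Definition double (t : int * int * int) : int * int * int :=
  let: (p, m, r) := t in
  (p ^+ 4 - 16 * m ^+ 4, 2 * p * m * r,
   p ^+ 8 - 32 * p ^+ 6 * m ^+ 2 + 96 * p ^+ 4 * m ^+ 4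
     - 512 * p ^+ 2 * m ^+ 6 + 256 * m ^+ 8).

Definition odd_model (n : nat) (t : int * int * int) : Prop :=
  let: (p, m, r) := t in
  [/\ on_model p m r, odd `|p|, odd `|r|
    & exists2 e : int, odd `|e| & m = 2 ^+ n.+1 * e].

Lemma odd_abszD (x y : int) : odd `|(x + y)%R| = odd `|x| (+) odd `|y|.
Proof. lia. Qed.

Lemma odd_double_model (n : nat) (t : int * int * int) :
  odd_model n t -> odd_model n.+1 (double t).
Proof.
case: t => [[p m] r] [Hr op or [e oe me]]; split.
- rewrite /on_model in Hr *.
  (* Once the fourth power is a square of a square, [r] enters the right side only through [r ^+ 2],
     which [Hr] eliminates. *)
  by rewrite [X in _ + 16 * X](exprM _ 2 2) ![(_ * r) ^+ 2]exprMn Hr; ring.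
- by rewrite odd_abszD abszN abszX oddX op abszM oddM.
- by rewrite !odd_abszD !abszN abszX oddX op !abszM !oddM.
- exists (p * e * r); first by rewrite !abszM !oddM op oe or.
  by rewrite me (exprS 2 n.+1); ring.
Qed.

Definition model_point (n : nat) : int * int * int :=
  iter n double (15, 2, 191).

Lemma odd_model_point (n : nat) : odd_model n (model_point n).
Proof.
elim: n => [|n IHn]; last exact: odd_double_model.
by split=> //; exists 1.
Qed.

Lemma odd_absz_neq0 (x : int) : odd `|x| -> x%:~R != 0 :> rat.
Proof. by rewrite intr_eq0; apply: contraTneq => ->. Qed.

Lemma logn2_pow2M_odd (k : nat) (a : int) :
  odd `|a| -> logn 2 `|(2 ^+ k * a)%R| = k.
Proof.
move=> oa; have a_gt0 : (0 < `|a|)%N by rewrite odd_gt0.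
rewrite abszM abszX lognM ?expn_gt0 // lognX muln1.
by rewrite [X in (_ + X)%N]lognE dvdn2 oa andbF addn0.
Qed.

Definition curve_point (n : nat) : rat * rat :=
  let: (p, m, r) := model_point n in
  (curveX p%:~R m%:~R r%:~R, curveY p%:~R m%:~R r%:~R).

(** As [p], [r] are odd and [m] even, [p^2 - m^2] and [p (r + p m)] are odd: the denominators do not
    vanish, and X has the 2-adic valuation of [4 m]. *)
Lemma curve_pointP (n : nat) :
  curve_pi3_pi2 (curve_point n) /\
  exists a b : int, [/\ odd `|a|, odd `|b|
    & (curve_point n).1 = (2 ^+ n.+3 * a)%:~R / b%:~R].
Proof.
rewrite /curve_point; have := odd_model_point n.
case: (model_point n) => [[p m] r] [Hr op or [e oe me]].
have om : odd `|m| = false by rewrite me abszM abszX oddM oddX.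
have od : odd `|(r + p * m)%R| by rewrite odd_abszD abszM oddM om or andbF.
split.
  apply: curve_of_model; last 2 first.
  - exact: odd_absz_neq0.
  - by rewrite -intrM -intrD; apply: odd_absz_neq0.
  move/(congr1 (fun z : int => z%:~R : rat)): Hr; rewrite /on_model.
  by rewrite !(rmorphXn, rmorphD, rmorphN, rmorphM).
exists (e * (p ^+ 2 - m ^+ 2)), (p * (r + p * m)); split.
- by rewrite abszM oddM oe odd_abszD abszN !abszX !oddX op om.
- by rewrite abszM oddM op od.
rewrite /= /curveX !(rmorphXn, rmorphB, rmorphD, rmorphM) /=.
have -> : m%:~R = 2 ^+ n.+1 * e%:~R :> rat by rewrite me rmorphM rmorphXn.
by rewrite (exprS 2 n.+2) (exprS 2 n.+1); congr (_ / _); ring.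
Qed.

Lemma curve_point_inj : injective curve_point.
Proof.
move=> i j /(congr1 fst).
have [_ [a [b [oa ob ->]]]] := curve_pointP i.
have [_ [c [d [oc od ->]]]] := curve_pointP j.
move/eqP; rewrite eqr_div ?odd_absz_neq0 // -!intrM eqr_int => /eqP.
(* Each side is now a power of 2 times an odd integer; valuations give [i + 3 = j + 3]. *)
rewrite -[_ * a * d]mulrA -[_ * c * b]mulrA => /(congr1 (fun z => logn 2 `|z|)).
by rewrite !logn2_pow2M_odd ?abszM ?oddM ?oa ?ob ?oc ?od // => -[].
Qed.

Theorem theorem1 : infinite_set curve_pi3_pi2.
Proof.
(* The preimage of the curve under [curve_point] is all of [nat]. *)
move=> /(finite_preimage (in2W curve_point_inj)) fin.
by apply: infinite_nat; apply: sub_finite_set fin => n _; case: (curve_pointP n).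
Qed.
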